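(* Let $V\subset\{1,\dots,15\}$ be a seven-element set of indices such that $m\oplus n\in V$ for all distinct $m,n\in V$. Then $V$ is flowmorphic to the Octonion index set $\{1,\dots,7\}$ if and only if $V$ harbors no zero-divisors. The flowmorphic ones are $\{1,\dots,7\}$ itself and the seven sets $V$ with $8\in V$. Furthermore, for a set $V$ that harbors zero-divisors, no replacement of some of the units $i_n$, $n\in V$, by their negatives makes $V$ flowmorphic to the Octonion index set.
   Context: The Sedenions are the 16-dimensional real (non-associative, distributive) algebra with basis $1,i_1,\dots,i_{15}$, where $1$ is the unit, $i_n^2=-1$, $i_mi_n=-i_ni_m$ for $m\ne n$, and for each triplet $(a,b,c)$ in the following list $i_ai_b=i_c$, $i_bi_c=i_a$, $i_ci_a=i_b$. O-trips: (1,2,3),(1,4,5),(1,7,6),(2,4,6),(2,5,7),(3,4,7),(3,6,5). S-trips: (1,8,9),(1,11,10),(1,13,12),(1,14,15),(2,8,10),(2,9,11),(2,14,12),(2,15,13),(3,8,11),(3,10,9),(3,15,12),(3,13,14),(4,8,12),(4,9,13),(4,10,14),(4,11,15),(5,8,13),(5,12,9),(5,10,15),(5,14,11),(6,8,14),(6,15,9),(6,12,10),(6,11,13),(7,8,15),(7,9,14),(7,13,10),(7,12,11). Thus $i_mi_n=\pm i_{m\oplus n}$, where $\oplus$ is bitwise XOR. A seven-element XOR-closed set $V$ carries the structure of a Fano plane whose lines are the triples $\{m,n,m\oplus n\}$; each line is cyclically oriented by the multiplication (the cyclic order $(a,b,c)$ with $i_ai_b=i_c$). $V$ is flowmorphic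 to $\{1,\dots,7\}$ if there is a bijection $\{1,\dots,7\}\to V$ carrying each of the seven cyclically oriented O-trips to an oriented line of $V$ with the same orientation. When some units $i_n$ are replaced by their negatives, the orientations are recomputed using the new units. $V$ harbors zero-divisors if there are distinct $A,B\in V$ and distinct $C,D\in V$ and signs $s,t\in\{\pm1\}$ with $(i_A+s\,i_B)(i_C+t\,i_D)=0$. *)

(* Defs.v *)
From HB Require Import structures.
From mathcomp Require Import all_boot all_order all_algebra.
From mathcomp Require Import reals.

Set Implicit Arguments.
Unset Strict Implicit.
Unset Printing Implicit Defensive.

Import Order.TTheory GRing.Theory Num.Theory.
Local Open Scope ring_scope.

Definition Otrips : seq (nat * nat * nat) :=
  [:: (1, 2, 3); (1, 4, 5); (1, 7, 6); (2, 4, 6); (2, 5, 7); (3, 4, 7);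
      (3, 6, 5)]%N.

Definition Strips : seq (nat * nat * nat) :=
  [:: (1, 8, 9); (1, 11, 10); (1, 13, 12); (1, 14, 15);
      (2, 8, 10); (2, 9, 11); (2, 14, 12); (2, 15, 13);
      (3, 8, 11); (3, 10, 9); (3, 15, 12); (3, 13, 14);
      (4, 8, 12); (4, 9, 13); (4, 10, 14); (4, 11, 15);
      (5, 8, 13); (5, 12, 9); (5, 10, 15); (5, 14, 11);
      (6, 8, 14); (6, 15, 9); (6, 12, 10); (6, 11, 13);
      (7, 8, 15); (7, 9, 14); (7, 13, 10); (7, 12, 11)]%N.

(* (a, b, c) is a cyclic rotation of a listed triplet. *)
Definition is_trip (a b c : nat) : bool :=
  let T := Otrips ++ Strips in
  [|| (a, b, c) \in T, (b, c, a) \in T | (c, a, b) \in T].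

(* Structure constants: the coefficient of i_k in i_m i_n, where i_0 is the
   unit 1. *)
Definition sed_coef (R : realType) (m n k : 'I_16) : R :=
  if m == ord0 then (k == n)%:R
  else if n == ord0 then (k == m)%:R
  else if m == n then - (k == ord0)%:R
  else if is_trip m n k then 1
  else if is_trip n m k then -1
  else 0.

(* The Sedenions are the real vector space 'rV[R]_16 with this product; index 0
   carries the coordinate along 1 and index n the coordinate along i_n. *)
Definition sed_mul (R : realType) (x y : 'rV[R]_16) : 'rV[R]_16 :=
  \row_k \sum_m \sum_n sed_coef R m n k * (x 0 m * y 0 n).

Definition sed_unit (R : realType) (n : 'I_16) : 'rV[R]_16 := delta_mx 0 n.

(* The units after replacing i_n by - i_n for every n in N. *)
Definition neg_units (R : realType) (N : {set 'I_16}) (n : 'I_16) : 'rV[R]_16 :=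
  if n \in N then - sed_unit R n else sed_unit R n.

(* m XOR n < 16 whenever m, n < 16, so inord never truncates (xor_idxE). *)
Definition xor_idx (m n : 'I_16) : 'I_16 := inord (Nat.lxor m n).

Definition fano_set (V : {set 'I_16}) : bool :=
  [&& ord0 \notin V, #|V| == 7%N &
      [forall m in V, forall n in V, (m != n) ==> (xor_idx m n \in V)]].

Definition oct_set : {set 'I_16} := [set n : 'I_16 | (1 <= n <= 7)%N].

(* {a, b, c} is a line of V whose cyclic orientation, computed with the units
   u, is (a, b, c). *)
Definition oriented_line (R : realType) (u : 'I_16 -> 'rV[R]_16)
    (V : {set 'I_16}) (a b c : 'I_16) : Prop :=
  [/\ [/\ a \in V, b \in V & c \in V], a != b, c = xor_idx a b &
      [/\ sed_mul (u a) (u b) = u c, sed_mul (u b) (u c) = u a &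
          sed_mul (u c) (u a) = u b]].

(* The bijection {1, ..., 7} -> V is the restriction of f to oct_set; the values
   of f elsewhere are irrelevant. *)
Definition flowmorphic (R : realType) (u : 'I_16 -> 'rV[R]_16)
    (V : {set 'I_16}) : Prop :=
  exists f : 'I_16 -> 'I_16,
    [/\ {in oct_set &, injective f}, f @: oct_set = V &
        forall a b c : 'I_16, (nat_of_ord a, nat_of_ord b, nat_of_ord c) \in Otrips ->
          oriented_line u V (f a) (f b) (f c)].

Definition harbors_zero_divisors (R : realType) (V : {set 'I_16}) : Prop :=
  exists A B C D : 'I_16,
    [/\ [/\ A \in V, B \in V & A != B], [/\ C \in V, D \in V & C != D] &
        exists s t : bool,
          sed_mul (sed_unit R A + (-1) ^+ s *: sed_unit R B)
                  (sed_unit R C + (-1) ^+ t *: sed_unit R D) = 0].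

Lemma xor_idxE (m n : 'I_16) : xor_idx m n = Nat.lxor m n :> nat.
Proof.
rewrite inordK //.
have: all (fun a => all (fun b => Nat.lxor a b < 16)%N (iota 0 16)) (iota 0 16).
  by vm_compute.
move/allP/(_ (m : nat)); rewrite mem_iota ltn_ord => /(_ isT).
by move/allP/(_ (n : nat)); rewrite mem_iota ltn_ord => /(_ isT).
Qed.

Lemma sed_mul_unit (R : realType) (m n : 'I_16) :
  sed_mul (sed_unit R m) (sed_unit R n) = \row_k sed_coef R m n k.
Proof.
apply/rowP => k; rewrite !mxE (bigD1 m) //= (bigD1 n) //= !mxE !eqxx !mulr1.
rewrite big1 ?addr0 => [|j jn]; last by rewrite !mxE (negbTE jn) !mulr0.
rewrite big1 ?addr0 // => i im; rewrite big1 // => j _.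
by rewrite !mxE (negbTE im) mul0r mulr0.
Qed.

(* The listed triplets decide every product: for distinct m, n in {1, ..., 15},
   exactly one of (m, n, m XOR n), (n, m, m XOR n) is a triplet, and
   (m, n, k) is not one for k <> m XOR n. *)
Lemma is_trip_xor (m n k : 'I_16) : m != ord0 -> n != ord0 -> m != n ->
  is_trip m n k || is_trip n m k = (k == xor_idx m n)
  /\ ~~ (is_trip m n k && is_trip n m k).
Proof.
move=> m0 n0 mn; rewrite -val_eqE /= xor_idxE.
have: all (fun a => all (fun b => all (fun c =>
    [&& a != 0, b != 0 & a != b]%N ==>
    ((is_trip a b c || is_trip b a c == (c == Nat.lxor a b))
     && ~~ (is_trip a b c && is_trip b a c)))
    (iota 0 16)) (iota 0 16)) (iota 0 16) by vm_compute.
move/allP/(_ (m : nat)); rewrite mem_iota ltn_ord => /(_ isT).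
move/allP/(_ (n : nat)); rewrite mem_iota ltn_ord => /(_ isT).
move/allP/(_ (k : nat)); rewrite mem_iota ltn_ord => /(_ isT).
by move: m0 n0 mn; rewrite -!val_eqE /= => -> -> -> /andP[/eqP].
Qed.

(* Main.v *)
(* The relation i_m i_n = +- i_(m XOR n) turns (i_A + s i_B)(i_C + t i_D) = 0 into
   A XOR C = B XOR D together with the equality of the sign products e(A,C) e(B,D)
   and e(A,D) e(B,C).  Changing the signs of units multiplies both sign products by
   the same factor, so this condition is invariant under re-signing and is
   transported by flow-preserving bijections; it never holds in the octonions.
   Hence a set that is flowmorphic, even after re-signing, has no zero-divisors.
   Conversely the Fano sets are the 15 punctured hyperplanes of F_2^4: eight of
   them carry an explicit XOR-linear flow-preserving bijection from {1, ..., 7},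
   the seven others an explicit zero-divisor. *)
Require Import Defs.
From mathcomp Require Import all_boot all_order all_algebra.
From mathcomp Require Import reals.

Set Implicit Arguments.
Unset Strict Implicit.
Unset Printing Implicit Defensive.

Import Order.TTheory GRing.Theory Num.Theory.
Local Open Scope ring_scope.

(** * Finite checks carried over from naturals to indices, and the laws of XOR *)

Lemma all_ord16 (p : pred nat) : all p (iota 0 16) -> forall i : 'I_16, p i.
Proof. by move=> /allP h i; apply: h; rewrite mem_iota ltn_ord. Qed.

Lemma all_ord16_2 (p : rel nat) :
  all (fun a => all (p a) (iota 0 16)) (iota 0 16) -> forall i j : 'I_16, p i j.
Proof. by move=> h i; apply/all_ord16/(all_ord16 h). Qed.

Lemma all_ord16_3 (p : nat -> rel nat) :
  all (fun a => all (fun b => all (p a b) (iota 0 16)) (iota 0 16)) (iota 0 16) ->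
  forall i j k : 'I_16, p i j k.
Proof. by move=> h i; apply/all_ord16_2/(all_ord16 h). Qed.

Lemma xor_idxC : commutative xor_idx.
Proof.
move=> m n; apply/val_inj; rewrite /= !xor_idxE; apply/eqP.
by move: m n; apply: (@all_ord16_2 (fun a b => Nat.lxor a b == Nat.lxor b a)); vm_compute.
Qed.

Lemma xor_idx_inj m : injective (xor_idx m).
Proof.
move=> n p /(congr1 val); rewrite /= !xor_idxE => /eqP E; apply/val_inj/eqP; move: E.
apply/implyP; move: m n p.
by apply: (@all_ord16_3 (fun a b c => (Nat.lxor a b == Nat.lxor a c) ==> (b == c))); vm_compute.
Qed.

Lemma xor_idx_injl m : injective (xor_idx^~ m).
Proof. by move=> n p; rewrite !(xor_idxC _ m) => /xor_idx_inj. Qed.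

Lemma xor_idx0l : left_id ord0 xor_idx.
Proof.
move=> n; apply/val_inj; rewrite /= xor_idxE; apply/eqP; move: n.
by apply: (@all_ord16 (fun a => Nat.lxor 0 a == a)); vm_compute.
Qed.

Lemma xor_idx0r : right_id ord0 xor_idx.
Proof. by move=> n; rewrite xor_idxC xor_idx0l. Qed.

Lemma xor_idxx m : xor_idx m m = ord0.
Proof.
apply/val_inj; rewrite /= xor_idxE; apply/eqP; move: m.
by apply: (@all_ord16 (fun a => Nat.lxor a a == 0%N)); vm_compute.
Qed.

(** * Signs of the products of units *)

(* [i_m i_n = (-1)^(sed_sign m n) i_(m XOR n)], including [m = 0], [n = 0] and [m = n]. *)
Definition sed_sign (m n : nat) : bool :=
  [&& m != 0, n != 0 & ~~ is_trip m n (Nat.lxor m n)]%N.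

Lemma sed_sign_anti (m n : 'I_16) :
  m != ord0 -> n != ord0 -> m != n -> sed_sign m n = ~~ sed_sign n m.
Proof.
move=> m0 n0 mn; apply/eqP.
have := @all_ord16_2 (fun a b => [&& a != 0, b != 0 & a != b]%N ==>
  (sed_sign a b == ~~ sed_sign b a)) isT m n.
by rewrite -!val_eqE /= in m0 n0 mn *; rewrite m0 n0 mn.
Qed.

Lemma sed_mul_unitE (R : realType) (m n : 'I_16) :
  sed_mul (sed_unit R m) (sed_unit R n) =
  (-1) ^+ sed_sign m n *: sed_unit R (xor_idx m n).
Proof.
rewrite sed_mul_unit; apply/rowP => k; rewrite !mxE eqxx /= /sed_coef /sed_sign.
have [->|m0] := eqVneq m ord0; first by rewrite xor_idx0l expr0 mul1r.
have [->|n0] := eqVneq n ord0; first by rewrite xor_idx0r /= andbF expr0 mul1r.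
have [<-|mn] := eqVneq m n.
  (* [Nat.lxor m m] is 0, which occurs in no triplet, so the sign of a square comes out as -1. *)
  rewrite xor_idxx; suff -> : ~~ is_trip m m (Nat.lxor m m).
    by rewrite -(inj_eq val_inj) /= in m0; rewrite m0 expr1 mulN1r.
  by move: m {m0 n0}; apply: (@all_ord16 (fun m => ~~ is_trip m m (Nat.lxor m m))); vm_compute.
have [] := is_trip_xor k m0 n0 mn.
rewrite -xor_idxE.
rewrite -(inj_eq val_inj) /= in m0; rewrite -(inj_eq val_inj) /= in n0; rewrite m0 n0 /=.
have [->|_] := eqVneq k (xor_idx m n).
  case: (is_trip m n _) => /=; first by rewrite expr0 mul1r.
  by move=> ->; rewrite mulr1.
by move=> /norP[/negPf-> /negPf->]; rewrite mulr0.
Qed.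

Lemma sed_mul_unit_pos (R : realType) (a b c : 'I_16) :
  c = xor_idx a b -> ~~ sed_sign a b -> sed_mul (sed_unit R a) (sed_unit R b) = sed_unit R c.
Proof. by move=> -> /negPf s; rewrite sed_mul_unitE s expr0 scale1r. Qed.

(** * Bilinearity of the product *)

Lemma sed_mulDl (R : realType) (x y z : 'rV[R]_16) :
  sed_mul (x + y) z = sed_mul x z + sed_mul y z.
Proof.
apply/rowP => k; rewrite !mxE -big_split; apply: eq_bigr => m _ /=.
by rewrite -big_split; apply: eq_bigr => n _ /=; rewrite mxE mulrDl mulrDr.
Qed.

Lemma sed_mulDr (R : realType) (x y z : 'rV[R]_16) :
  sed_mul x (y + z) = sed_mul x y + sed_mul x z.
Proof.
apply/rowP => k; rewrite !mxE -big_split; apply: eq_bigr => m _ /=.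
by rewrite -big_split; apply: eq_bigr => n _ /=; rewrite mxE !mulrDr.
Qed.

Lemma sed_mulZl (R : realType) (a : R) (x y : 'rV[R]_16) :
  sed_mul (a *: x) y = a *: sed_mul x y.
Proof.
apply/rowP => k; rewrite !mxE big_distrr; apply: eq_bigr => m _ /=.
rewrite big_distrr; apply: eq_bigr => n _ /=.
by rewrite mxE -(mulrA a) mulrCA.
Qed.

Lemma sed_mulZr (R : realType) (a : R) (x y : 'rV[R]_16) :
  sed_mul x (a *: y) = a *: sed_mul x y.
Proof.
apply/rowP => k; rewrite !mxE big_distrr; apply: eq_bigr => m _ /=.
rewrite big_distrr; apply: eq_bigr => n _ /=.
by rewrite mxE [RHS]mulrCA (mulrCA a).
Qed.

(** * Zero products of two-term sums *)

Lemma sign_eq (R : realType) (s t : bool) : ((-1) ^+ s == (-1) ^+ t :> R) = (s == t).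
Proof. by rewrite (inj_eq signr_inj). Qed.

Lemma signed_unit_inj (R : realType) (s t : bool) (m n : 'I_16) :
  (-1) ^+ s *: sed_unit R m = (-1) ^+ t *: sed_unit R n -> m = n /\ s = t.
Proof.
move=> /rowP/(_ m); rewrite !mxE !eqxx /= mulr1.
have [<-|_] := eqVneq m n; first by rewrite mulr1 => /eqP; rewrite sign_eq => /eqP.
by rewrite mulr0 => /eqP; rewrite signr_eq0.
Qed.

(** The expanded product consists of four signed units. As XOR is cancellative, the [A C] term
    shares its index neither with [A D] nor with [B C], so it can only cancel against [B D];
    likewise [A D] only against [B C]. *)
Lemma sed_mul_zeroP (R : realType) (A B C D : 'I_16) (s t : bool) :
  A != B -> C != D ->
  sed_mul (sed_unit R A + (-1) ^+ s *: sed_unit R B)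
          (sed_unit R C + (-1) ^+ t *: sed_unit R D) = 0 <->
  [/\ xor_idx A C = xor_idx B D, xor_idx A D = xor_idx B C,
      s (+) t (+) sed_sign A C (+) sed_sign B D &
      s (+) t (+) sed_sign A D (+) sed_sign B C].
Proof.
move=> AB CD; rewrite sed_mulDl !sed_mulDr !sed_mulZl !sed_mulZr !sed_mul_unitE.
rewrite !scalerA -!signr_addb.
have nr X : (xor_idx X C == xor_idx X D) = false.
  by rewrite (inj_eq (@xor_idx_inj X)) (negPf CD).
have nl X : (xor_idx A X == xor_idx B X) = false.
  by rewrite (inj_eq (@xor_idx_injl X)) (negPf AB).
have nr' X : (xor_idx X D == xor_idx X C) = false by rewrite eq_sym nr.
split=> [E|[E1 E2 h1 h2]]; last first.
  rewrite -E1 -E2 [X in _ + X]addrC addrACA -!scalerDl.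
  move: s t (sed_sign A C) (sed_sign A D) (sed_sign B C) (sed_sign B D) h1 h2.
  by do 6!case=> //=; rewrite ?expr0 ?expr1 ?subrr ?addNr !scale0r addr0.
have sumsign (p q : bool) (b : bool) :
    (-1) ^+ p + (-1) ^+ q * b%:R = 0 :> R -> b /\ p (+) q.
  case: b; last by rewrite mulr0 addr0 => /eqP; rewrite signr_eq0.
  by rewrite mulr1 => /eqP; rewrite addr_eq0 -signrN sign_eq; case: p q => -[]; split.
(* At this coordinate only the [A C] term, and possibly the [B D] term, survives. *)
have := congr1 (fun v : 'rV[R]_16 => v 0 (xor_idx A C)) E.
rewrite !mxE !eqxx /= nr nl !mulr0 mulr1 addr0 add0r => /sumsign[/eqP E1 h1].
have := congr1 (fun v : 'rV[R]_16 => v 0 (xor_idx A D)) E.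
rewrite !mxE !eqxx /= nr' nl !mulr0 mulr1 addr0 add0r => /sumsign[/eqP E2 h2].
split=> //.
  by move: s t (sed_sign A C) (sed_sign B D) {E h2} h1; do 4!case.
by move: s t (sed_sign A D) (sed_sign B C) {E h1} h2; do 4!case.
Qed.

(** The signs enter both cancellation conditions only through [s (+) t]; a suitable value exists
    exactly when the two conditions ask for the same one. *)
Lemma harbors_zero_divisorsP (R : realType) (V : {set 'I_16}) :
  harbors_zero_divisors R V <->
  exists A B C D : 'I_16,
    [/\ [/\ A \in V, B \in V & A != B], [/\ C \in V, D \in V & C != D],
        xor_idx A C = xor_idx B D, xor_idx A D = xor_idx B C &
        ~~ (sed_sign A C (+) sed_sign B D (+) sed_sign A D (+) sed_sign B C)].
Proof.
split=> -[A [B [C [D]]]].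
  case=> [[AV BV AB] [CV DV CD] [s [t /(sed_mul_zeroP _ _ _ AB CD)[E1 E2 h1 h2]]]].
  exists A, B, C, D; split=> //.
  move: s t (sed_sign A C) (sed_sign B D) (sed_sign A D) (sed_sign B C) h1 h2.
  by do 6!case.
case=> [[AV BV AB] [CV DV CD] E1 E2 h]; exists A, B, C, D; split=> //.
exists (~~ (sed_sign A C (+) sed_sign B D)), false.
apply/sed_mul_zeroP => //; split=> //.
  by case: (sed_sign A C) (sed_sign B D) => -[].
by move: (sed_sign A C) (sed_sign B D) (sed_sign A D) (sed_sign B C) h; do 4!case.
Qed.

(** * Re-signed units *)

Lemma neg_unitsE (R : realType) (N : {set 'I_16}) n :
  neg_units R N n = (-1) ^+ (n \in N) *: sed_unit R n.
Proof. by rewrite /neg_units; case: ifP; rewrite ?expr0 ?expr1 ?scaleN1r ?scale1r. Qed.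

Lemma neg_units0 (R : realType) : neg_units R set0 =1 sed_unit R.
Proof. by move=> n; rewrite /neg_units inE. Qed.

(** Re-signing twists the signs by the coboundary of the indicator of [N]. *)
Lemma neg_units_mulP (R : realType) (N : {set 'I_16}) (a b c : 'I_16) :
  sed_mul (neg_units R N a) (neg_units R N b) = neg_units R N c <->
  c = xor_idx a b /\ sed_sign a b = (a \in N) (+) (b \in N) (+) (c \in N).
Proof.
rewrite !neg_unitsE sed_mulZl sed_mulZr sed_mul_unitE !scalerA -!signr_addb.
split=> [/signed_unit_inj[-> <-]|[-> ->]].
  by split=> //; case: (a \in N) (b \in N) (sed_sign a b) => -[] [].
congr ((-1) ^+ (nat_of_bool _) *: _).
by case: (a \in N) (b \in N) (xor_idx a b \in N) => -[] [].
Qed.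

Lemma flowmorphic_neg_units0 (R : realType) (V : {set 'I_16}) :
  flowmorphic (sed_unit R) V <-> flowmorphic (neg_units R set0) V.
Proof.
by split=> -[f [finj fV fl]]; exists f; split=> // a b c /fl;
  rewrite /oriented_line !neg_units0.
Qed.

(** * Octonion signs, and zero-divisors as an obstruction to flowmorphism *)

Definition oct_trip (a b c : nat) : bool :=
  [|| (a, b, c) \in Otrips, (b, c, a) \in Otrips | (c, a, b) \in Otrips].

(** Up to rotation and swap, the seven O-trips cover all pairs of distinct Octonion units, so a map
    respecting them has all signs on its image determined. *)
Lemma oct_tripP (a b : 'I_16) : a \in oct_set -> b \in oct_set -> a != b ->
  xor_idx a b \in oct_set /\
  if sed_sign a b then oct_trip b a (xor_idx a b) else oct_trip a b (xor_idx a b).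
Proof.
have := @all_ord16_2 (fun a b => [&& 1 <= a <= 7, 1 <= b <= 7 & a != b]%N ==>
  (1 <= Nat.lxor a b <= 7)%N && if sed_sign a b then oct_trip b a (Nat.lxor a b)
  else oct_trip a b (Nat.lxor a b)) isT a b.
by rewrite !inE -xor_idxE -val_eqE /= => h aO bO ab; move: h; rewrite aO bO ab => /andP.
Qed.

(** A combinatorial trace of the Octonions being a division algebra, verified over all
    quadruples. *)
Lemma oct_no_zero_divisors (a b c d : 'I_16) :
  a \in oct_set -> b \in oct_set -> c \in oct_set -> d \in oct_set ->
  a != b -> c != d -> xor_idx a c = xor_idx b d ->
  sed_sign a c (+) sed_sign b d (+) sed_sign a d (+) sed_sign b c.
Proof.
have chk : all (fun a => all (fun b => all (fun c => all (fun d =>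
    [&& a != b, c != d & Nat.lxor a c == Nat.lxor b d] ==>
    (sed_sign a c (+) sed_sign b d (+) sed_sign a d (+) sed_sign b c))
    (iota 1 7)) (iota 1 7)) (iota 1 7)) (iota 1 7) by vm_compute.
have mem n : n \in oct_set -> (n : nat) \in iota 1 7 by rewrite inE mem_iota.
move=> /mem aO /mem bO /mem cO /mem dO ab cd /(congr1 val) /=; rewrite !xor_idxE => /eqP E.
move: chk => /allP/(_ _ aO)/allP/(_ _ bO)/allP/(_ _ cO)/allP/(_ _ dO).
by rewrite E !val_eqE ab cd.
Qed.

Lemma sed_sign_diag (m : 'I_16) : m != ord0 -> sed_sign m m.
Proof.
rewrite -val_eqE; apply/implyP; move: m.
by apply: (@all_ord16 (fun m => (m != 0)%N ==> sed_sign m m)); vm_compute.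
Qed.

(* The extension of [f] by [f 0 = 0] is additive for XOR and carries the signs of
   the octonions to those of [V] up to a coboundary; such a twist does not
   affect the sign condition characterising zero-divisors. *)
Lemma flowmorphic_no_zero_divisors (R : realType) (N V : {set 'I_16}) :
  ord0 \notin V -> flowmorphic (neg_units R N) V -> ~ harbors_zero_divisors R V.
Proof.
move=> V0 [f [finj fV fl]].
have fV' n : n \in oct_set -> f n \in V by move=> nO; rewrite -fV imset_f.
have f0 n : n \in oct_set -> f n != ord0.
  by move=> /fV' fnV; apply: contraNneq V0 => <-.
have O0 n : n \in oct_set -> (n == ord0) = false.
  by rewrite inE; apply: contraTF => /eqP->.
have ftrip (a b c : 'I_16) : oct_trip a b c -> f c = xor_idx (f a) (f b) /\
    sed_sign (f a) (f b) = (f a \in N) (+) (f b \in N) (+) (f c \in N).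
  by move=> h; apply/(neg_units_mulP R); case/or3P: h => /fl[_ _ _ []].
pose g n := if n == ord0 then ord0 else f n.
(* [N] may contain 0, yet the square of a unit is -1 under any re-signing; hence [nu] must vanish at
   0. *)
pose nu n := (n != ord0) && (n \in N).
have gmorph a b : a \in oct_set -> b \in oct_set ->
    g (xor_idx a b) = xor_idx (f a) (f b) /\
    sed_sign (f a) (f b) =
    sed_sign a b (+) (f a \in N) (+) (f b \in N) (+) nu (g (xor_idx a b)).
  move=> aO bO; have [<-|ab] := eqVneq a b.
    rewrite !xor_idxx /g eqxx /nu eqxx /= !sed_sign_diag ?f0 ?O0 //.
    by case: (_ \in N).
  have fab : f a != f b by apply: contraNneq ab => /finj->.
  have [cO] := oct_tripP aO bO ab; rewrite /g /nu O0 // f0 //=.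
  case: ifP => _ /ftrip[fc E]; last by [].
  split; first by rewrite fc xor_idxC.
  rewrite sed_sign_anti ?f0 // E.
  by case: (f a \in N) (f b \in N) (f (xor_idx a b) \in N) => -[] [].
(* Index 0 is included because [xor_idx a c] vanishes when [a = c]. *)
have ginj a b : a \in ord0 |: oct_set -> b \in ord0 |: oct_set -> g a = g b -> a = b.
  rewrite !in_setU1 /g => /orP[/eqP->|aO] /orP[/eqP->|bO]; rewrite ?eqxx ?O0 //.
  - by move/esym/eqP; rewrite (negPf (f0 _ bO)).
  - by move/eqP; rewrite (negPf (f0 _ aO)).
  exact: finj.
have xorO a b : a \in oct_set -> b \in oct_set -> xor_idx a b \in ord0 |: oct_set.
  move=> aO bO; have [<-|ab] := eqVneq a b; first by rewrite xor_idxx setU11.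
  by have [cO _] := oct_tripP aO bO ab; rewrite in_setU1 cO orbT.
case/harbors_zero_divisorsP => A [B [C [D []]]]; rewrite -fV.
case=> /imsetP[a aO ->] /imsetP[b bO ->] ab.
case=> /imsetP[c cO ->] /imsetP[d dO ->] cd.
have [eac sac] := gmorph _ _ aO cO; have [ebd sbd] := gmorph _ _ bO dO.
have [ead sad] := gmorph _ _ aO dO; have [ebc sbc] := gmorph _ _ bO cO.
rewrite -eac -ebd -ead -ebc => Eac Ead; rewrite sac sbd sad sbc Eac Ead.
have ab' : a != b by apply: contraNneq ab => ->.
have cd' : c != d by apply: contraNneq cd => ->.
have Eacbd := ginj _ _ (xorO _ _ aO cO) (xorO _ _ bO dO) Eac.
have := oct_no_zero_divisors aO bO cO dO ab' cd' Eacbd.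
(* Each membership bit occurs in two of the four signs, and each [nu] value occurs twice since the
   XORs agree pairwise; all of them cancel. *)
move: (sed_sign a c) (sed_sign b d) (sed_sign a d) (sed_sign b c).
move: (f a \in N) (f b \in N) (f c \in N) (f d \in N) (nu _) (nu _).
by do 10!case.
Qed.

(** * Fano sets as punctured hyperplanes *)

(* The Fano sets are the punctured hyperplanes of [F_2^4]: [w] is the linear form
   [n |-> parity (w AND n)]. *)
Definition in_hyperplane (w n : nat) : bool :=
  (n != 0)%N && ~~ odd (count (Nat.testbit (Nat.land w n)) (iota 0 4)).

Definition hyperplane (w : nat) : {set 'I_16} := [set n : 'I_16 | in_hyperplane w n].

Lemma card_set_ord n (p : pred nat) : #|[set i : 'I_n | p i]| = count p (iota 0 n).
Proof.
rewrite cardsE -sum1_card -sum1_count.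
by rewrite -[in RHS](subn0 n) -/(index_iota 0 n) big_mkord.
Qed.

(** A nonzero linear form on [F_2^4] vanishes on a subspace of 8 vectors, one of them 0. *)
Lemma fano_hyperplane (w : 'I_16) : w != ord0 -> fano_set (hyperplane w).
Proof.
move=> w0; apply/and3P; split; first by rewrite inE.
  rewrite card_set_ord; rewrite -val_eqE in w0; move: w0; apply/implyP; move: w.
  by apply: (@all_ord16 (fun w => (w != 0) ==> (count (in_hyperplane w) (iota 0 16) == 7))%N);
    vm_compute.
apply/forall_inP => m mw; apply/forall_inP => n nw; apply/implyP => mn.
move: mw nw mn; rewrite !inE xor_idxE -val_eqE /= => mw nw mn.
have := @all_ord16_3 (fun w m n => [&& in_hyperplane w m, in_hyperplane w n & m != n] ==>
  in_hyperplane w (Nat.lxor m n)) ltac:(by vm_compute) w m n.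
by rewrite mw nw mn.
Qed.

(** For independent [a], [b], [c], these are the nonzero vectors of their [F_2]-span. *)
Definition xor_span (a b c : nat) : seq nat :=
  let ab := Nat.lxor a b in
  [:: a; b; c; ab; Nat.lxor a c; Nat.lxor b c; Nat.lxor ab c].

(** The hypotheses express linear independence over [F_2]; the span then has dimension 3 and is the
    kernel of some form [w], found by search. *)
Lemma hyperplane_span (a b c : 'I_16) :
  a != ord0 -> b != ord0 -> c != ord0 -> b != a -> c != a -> c != b -> c != xor_idx a b ->
  exists2 w : 'I_16, w != ord0 &
    forall n : 'I_16, n \in hyperplane w -> (n : nat) \in xor_span a b c.
Proof.
rewrite -!val_eqE /= xor_idxE => a0 b0 c0 ba ca cb cab.
pose indep a b c := [&& a != 0, b != 0, c != 0, b != a, c != a, c != b & c != Nat.lxor a b]%N.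
have abc : indep a b c by rewrite /indep; apply/and5P; split=> //; apply/and3P.
have := @all_ord16_3 (fun a b c => if indep a b c then
    let s := xor_span a b c in
    has (fun w => all (fun n => in_hyperplane w n ==> (n \in s)) (iota 0 16))
      [seq w <- iota 1 15 | all (in_hyperplane w) [:: a; b; c]] else true)
  ltac:(by vm_compute) a b c.
rewrite abc => /hasP[w]; rewrite mem_filter => /andP[_].
rewrite mem_iota => /andP[w0 wlt] /all_ord16 sub.
exists (Ordinal wlt); first by rewrite -val_eqE -lt0n.
by move=> n; rewrite inE; apply/implyP/sub.
Qed.

Lemma fano_setP (V : {set 'I_16}) :
  fano_set V -> exists2 w : 'I_16, w != ord0 & V = hyperplane w.
Proof.
case/and3P=> V0 /eqP V7 /forall_inP Vx.
have xorV m n : m \in V -> n \in V -> m != n -> xor_idx m n \in V.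
  by move=> mV nV; apply/implyP; move: n nV; apply/forall_inP/Vx.
(* Independent [a], [b], [c] are picked greedily, each outside the span of the earlier ones; their
   seven XOR combinations lie in [V] and fill it by cardinality. *)
have pick3 (X : {set 'I_16}) : (#|X| <= 3)%N -> exists2 x, x \in V & x \notin X.
  move=> X3; have /subsetPn[x xV xX] : ~~ (V \subset X); last by exists x.
  by apply: contraTN X3 => /subset_leq_card; rewrite V7 -ltnNge; apply: leq_trans.
have [a aV _] := pick3 set0 ltac:(by rewrite cards0).
have [b bV] := pick3 [set a] ltac:(by rewrite cards1).
rewrite inE => ba.
have [c cV] : exists2 c, c \in V & c \notin [set a; b; xor_idx a b].
  by apply: pick3; rewrite (leq_trans (leq_card_setU _ _)) // cards1 cards2; case: eqP.
rewrite !inE !negb_or -andbA => /and3P[ca cb cab].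
have ab : a != b by rewrite eq_sym.
have abV : xor_idx a b \in V by exact: xorV.
have acV : xor_idx a c \in V by apply: xorV; rewrite // eq_sym.
have bcV : xor_idx b c \in V by apply: xorV; rewrite // eq_sym.
have abcV : xor_idx (xor_idx a b) c \in V by apply: xorV; rewrite // eq_sym.
have n0 n : n \in V -> n != ord0 by move=> nV; apply: contraNneq V0 => <-.
have [w w0 sub] := hyperplane_span (n0 _ aV) (n0 _ bV) (n0 _ cV) ba ca cb cab.
exists w => //; apply/esym/eqP; rewrite eqEcard V7.
have /and3P[_ /eqP-> _] := fano_hyperplane w0; rewrite leqnn andbT.
apply/subsetP => n /sub; rewrite /xor_span !inE -!xor_idxE !val_eqE.
by repeat case/orP=> [/eqP->//|]; move/eqP->.
Qed.

Lemma oct_set_hyperplane : oct_set = hyperplane 8.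
Proof.
apply/setP => n; rewrite !inE; apply/eqP; move: n.
by apply: (@all_ord16 (fun n => (1 <= n <= 7)%N == in_hyperplane 8 n)); vm_compute.
Qed.

(** The form [w] takes at 8 the value of the top bit of [w]. *)
Lemma mem8_hyperplane (w : 'I_16) : (inord 8 \in hyperplane w) = (w < 8)%N.
Proof.
rewrite inE inordK //; apply/eqP; move: w.
by apply: (@all_ord16 (fun w => in_hyperplane w 8 == (w < 8))%N); vm_compute.
Qed.

(** A linear form over [F_2] is determined by its zeros. *)
Lemma hyperplane_inj : injective (fun w : 'I_16 => hyperplane w).
Proof.
move=> v w vw; apply/val_inj/eqP.
have := @all_ord16_2 (fun v w => all (fun n => in_hyperplane v n == in_hyperplane w n)
  (iota 0 16) ==> (v == w)) ltac:(by vm_compute) v w.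
move=> /implyP; apply; apply/allP => n; rewrite mem_iota /= add0n => nlt.
by have /setP/(_ (Ordinal nlt)) := vw; rewrite !inE /= => ->.
Qed.

(** * Explicit zero-divisors and explicit flow-preserving bijections *)

(* Indices [A, B, C, D] of a zero-divisor pair in [hyperplane w], for [w = 9, ..., 15]. *)
Definition zero_divisor_quad (w : nat) : nat * nat * nat * nat :=
  nth (0, 0, 0, 0)%N [:: (2, 9, 4, 15); (1, 10, 4, 15); (3, 9, 4, 14); (1, 12, 2, 15);
                         (2, 9, 5, 14); (1, 10, 6, 13); (3, 9, 5, 15)]%N (w - 9).

Lemma hyperplane_zero_divisors (R : realType) (w : 'I_16) :
  (8 < w)%N -> harbors_zero_divisors R (hyperplane w).
Proof.
move=> w8; apply/harbors_zero_divisorsP.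
have := @all_ord16 (fun w => (8 < w)%N ==> let: (A, B, C, D) := zero_divisor_quad w in
  [&& [&& A < 16, B < 16, C < 16 & D < 16]%N,
      [&& in_hyperplane w A, in_hyperplane w B & A != B],
      [&& in_hyperplane w C, in_hyperplane w D & C != D],
      Nat.lxor A C == Nat.lxor B D, Nat.lxor A D == Nat.lxor B C &
      ~~ (sed_sign A C (+) sed_sign B D (+) sed_sign A D (+) sed_sign B C)])
  ltac:(by vm_compute) w.
rewrite w8; case: (zero_divisor_quad w) => [[[A B] C] D] /=.
case/and5P=> /and4P[Alt Blt Clt Dlt] /and3P[hA hB AB] /and3P[hC hD CD] E1 /andP[E2 h].
exists (Ordinal Alt), (Ordinal Blt), (Ordinal Clt), (Ordinal Dlt).
by split; rewrite ?inE //; apply/val_inj; rewrite /= !xor_idxE; apply/eqP.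
Qed.

(* The images of [i_1], [i_2], [i_4] under a flow-preserving bijection onto
   [hyperplane w], for [w = 1, ..., 8]. *)
Definition oct_frame (w : nat) : nat * nat * nat :=
  nth (0, 0, 0)%N [:: (2, 4, 8); (1, 4, 8); (3, 4, 8); (1, 2, 8); (2, 5, 8);
                      (1, 7, 8); (3, 6, 8); (1, 2, 4)]%N w.-1.

(** The XOR-linear extension of the frame along the binary digits of [n]; linearity sends lines to
    lines, and the frame is chosen so that orientations are kept. *)
Definition oct_map (w n : nat) : nat :=
  let: (x, y, z) := oct_frame w in
  let bit i v := if Nat.testbit n i then v else 0%N in
  Nat.lxor (bit 0 x) (Nat.lxor (bit 1 y) (bit 2 z)).

Lemma hyperplane_flowmorphic (R : realType) (w : 'I_16) :
  (1 <= w <= 8)%N -> flowmorphic (sed_unit R) (hyperplane w).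
Proof.
move=> w18; have [f fE] : exists f : 'I_16 -> 'I_16, forall n, f n = oct_map w n :> nat.
  exists (fun n => inord (oct_map w n)) => n; rewrite inordK //; move: w n {w18}.
  by apply: (@all_ord16_2 (fun w n => oct_map w n < 16))%N; vm_compute.
have finj : {in oct_set &, injective f}.
  move=> m n; rewrite !inE => mO nO /(congr1 val) /=; rewrite !fE => /eqP E.
  have := @all_ord16_3 (fun w m n => [&& 1 <= w <= 8, 1 <= m <= 7, 1 <= n <= 7 &
    oct_map w m == oct_map w n]%N ==> (m == n)) ltac:(by vm_compute) w m n.
  by rewrite w18 mO nO E => /eqP/val_inj.
have fV n : n \in oct_set -> f n \in hyperplane w.
  rewrite !inE fE => nO; have := @all_ord16_2 (fun w n => (1 <= w <= 8)%N && (1 <= n <= 7)%N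
    ==> in_hyperplane w (oct_map w n)) ltac:(by vm_compute) w n.
  by rewrite w18 nO.
have w0 : w != ord0 by rewrite -val_eqE -lt0n; case/andP: w18.
exists f; split=> //.
  apply/eqP; rewrite eqEcard; apply/andP; split.
    by apply/subsetP => _ /imsetP[n nO ->]; apply: fV.
  have /and3P[_ /eqP-> _] := fano_hyperplane w0.
  by rewrite card_in_imset // oct_set_hyperplane card_set_ord.
move=> a b c abc.
have chk : all (fun w => all (fun t => let: (a, b, c) := t in
    let u := oct_map w a in let v := oct_map w b in let x := oct_map w c in
    [&& 1 <= a <= 7, 1 <= b <= 7, 1 <= c <= 7, u != v,
        x == Nat.lxor u v, u == Nat.lxor v x, v == Nat.lxor x u,
        ~~ sed_sign u v, ~~ sed_sign v x & ~~ sed_sign x u]%N) Otrips) (iota 1 8).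
  by vm_compute.
have wI : (w : nat) \in iota 1 8 by rewrite mem_iota.
have /allP/(_ _ abc) := allP chk _ wI.
cbv beta iota zeta; rewrite -!fE -!xor_idxE !val_eqE.
case/and5P=> aO bO cO uv /and5P[/eqP xE /eqP uE /eqP vE suv /andP[svx sxu]].
have {}aO : a \in oct_set by rewrite inE.
have {}bO : b \in oct_set by rewrite inE.
have {}cO : c \in oct_set by rewrite inE.
split; [by split; apply: fV|exact: uv|exact: xE|].
by split; apply: sed_mul_unit_pos.
Qed.

(* The classification and the count *)
Local Close Scope ring_scope.

Theorem mainTheorem6 (R : realType) :
  (forall V : {set 'I_16}, fano_set V ->
     [/\ flowmorphic (sed_unit R) V <-> ~ harbors_zero_divisors R V,
         flowmorphic (sed_unit R) V <-> (V = oct_set \/ inord 8 \in V) &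
         harbors_zero_divisors R V ->
           forall N : {set 'I_16}, N \subset V -> ~ flowmorphic (neg_units R N) V])
  /\ fano_set oct_set
  /\ #|[set V : {set 'I_16} | fano_set V & inord 8 \in V]| = 7.
Proof.
have fano_oct : fano_set oct_set.
  have := @fano_hyperplane (inord 8); rewrite inordK // -oct_set_hyperplane; apply.
  by rewrite -val_eqE /= inordK.
split; last split=> //.
- move=> V fV; have /and3P[V0 _ _] := fV; have [w w0 VE] := fano_setP fV.
  have flow_nzd : flowmorphic (sed_unit R) V -> ~ harbors_zero_divisors R V.
    by rewrite flowmorphic_neg_units0; apply: flowmorphic_no_zero_divisors.
  (* All properties of [V] are compared with [w <= 8]: the form 8 gives [oct_set], and the smaller
     nonzero forms give the sets containing 8. *)
  have octE : V = oct_set \/ inord 8 \in V <-> w <= 8.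
    rewrite VE mem8_hyperplane oct_set_hyperplane; split=> [[E|/ltnW//]|].
      have -> : w = inord 8 by apply/hyperplane_inj; rewrite /= inordK.
      by rewrite inordK.
    by rewrite leq_eqVlt => /orP[/eqP->|]; [left|right].
  have le8_flow : w <= 8 -> flowmorphic (sed_unit R) V.
    by rewrite VE => w8; apply: hyperplane_flowmorphic; rewrite w8 andbT lt0n.
  have nzd_le8 : ~ harbors_zero_divisors R V -> w <= 8.
    by move=> nzd; rewrite leqNgt; apply/negP => w8; apply: nzd; rewrite VE;
      apply: hyperplane_zero_divisors.
  split; first by split=> // /nzd_le8/le8_flow.
    by rewrite octE; split=> // /flow_nzd/nzd_le8.
  by move=> zd N _ /(flowmorphic_no_zero_divisors V0).
(* The forms involved are 1 to 7, so [oct_set] doubles here as the set of their indices. *)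
- have -> : [set V : {set 'I_16} | fano_set V & inord 8 \in V] =
            [set hyperplane (w : 'I_16) | w in oct_set].
    apply/setP => V; rewrite !inE; apply/andP/imsetP => [[/fano_setP[w w0 ->]]|[w]].
      by rewrite mem8_hyperplane => w8; exists w; rewrite // inE lt0n w0.
    rewrite inE => /andP[w1 w7] ->; rewrite mem8_hyperplane; split=> //.
    by apply: fano_hyperplane; rewrite -val_eqE -lt0n.
  by rewrite (card_imset _ hyperplane_inj) oct_set_hyperplane card_set_ord.
Qed.
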